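(* For all $n\in\mathbb{N}$, $\mathcal{F}_{\mathfrak{S}_n}$ is equal to the number of conjugacy classes in $\mathfrak{S}_n$, where $\mathfrak{S}_n$ is the symmetric group on a finite set of $n$ symbols.
   Context: For a group $G$, $G^{fin}$ is the set of finite order elements. For $g\in G^{fin}$ of order $d$, $p_g=\frac{1+g+\cdots+g^{d-1}}{d}\in\mathbb{C}G$. The equivalence relation $\sim_{\mathrm{fin}}$ on $G^{fin}$: $g\sim_{\mathrm{fin}}h$ if and only if there is $\gamma\in G$ with $p_g=\gamma p_h\gamma^{-1}$; equivalently, $g$ and $h$ have the same order and some power $g^a$, $a\in\mathbb{N}$, is conjugate to $h$. $\mathcal{F}_G:=|G^{fin}/_{\sim_{\mathrm{fin}}}|$. *)

(* Defs.v *)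
From HB Require Import structures.
From mathcomp Require Import all_boot all_order all_fingroup all_algebra.
From mathcomp Require Import cyclic finmap complex boolp reals Rstruct.
From mathcomp Require Import monalg.
From Stdlib Require Rdefinitions.

Set Implicit Arguments.
Unset Strict Implicit.
Unset Printing Implicit Defensive.

Import GRing.Theory.

Local Open Scope ring_scope.

Definition CC : numClosedFieldType := complex Rdefinitions.R.

(* The group algebra R[G].  The product that the library puts on
   {malg R[K]} is restricted to monoids K without nontrivial units, which
   excludes groups; so only the R-module of finitely supported functions
   {malg R[G]} is reused, and the convolution product is put on an alias. *)
Definition group_algebra (R : nzRingType) (G : groupType) : Type := {malg R[G]}.

HB.instance Definition _ (R : nzRingType) (G : groupType) :=
  GRing.Lmodule.on (group_algebra R G).

Section GroupAlgebra.
Variables (R : nzRingType) (G : groupType).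
Local Notation A := (group_algebra R G).
Implicit Types (x y z : A) (g h : G).

Definition gadelta g : A := << g >>.

Definition gamul x y : A :=
  \sum_(g <- msupp x) \sum_(h <- msupp y) << x@_g * y@_h *g (g * h)%g >>.

Lemma gamulEw (d1 d2 : {fset G}) x y :
  (msupp x `<=` d1)%fset -> (msupp y `<=` d2)%fset ->
  gamul x y = \sum_(g <- d1) \sum_(h <- d2) << x@_g * y@_h *g (g * h)%g >>.
Proof.
move=> le_d1 le_d2; rewrite /gamul (big_fset_incl _ le_d1) /=.
  apply/eq_bigr=> k1 _; apply/big_fset_incl => // k _ /mcoeff_outdom ->.
  by rewrite mulr0 monalgU0.
move=> k _ /mcoeff_outdom g1k.
by rewrite big1 => // k' _; rewrite g1k mul0r monalgU0.
Qed.

Lemma gamul0l : left_zero 0 gamul.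
Proof. by move=> x; rewrite /gamul msupp0 big_seq_fset0. Qed.

Lemma gamul0r : right_zero 0 gamul.
Proof. by move=> x; rewrite /gamul exchange_big msupp0 big_seq_fset0. Qed.

Lemma gamulUl c g y :
  gamul << c *g g >> y = \sum_(h <- msupp y) << c * y@_h *g (g * h)%g >>.
Proof.
rewrite (gamulEw msuppU_le (fsubset_refl _)) big_seq_fset1.
by apply/eq_bigr => k' _; rewrite mcoeffUU.
Qed.

Lemma gamulUr c h x :
  gamul x << c *g h >> = \sum_(g <- msupp x) << x@_g * c *g (g * h)%g >>.
Proof.
rewrite (gamulEw (fsubset_refl _) msuppU_le) exchange_big big_seq_fset1.
by apply/eq_bigr => k' _; rewrite mcoeffUU.
Qed.

Lemma gamulUU c1 c2 g h :
  gamul << c1 *g g >> << c2 *g h >> = << c1 * c2 *g (g * h)%g >>.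
Proof. by rewrite (gamulEw msuppU_le msuppU_le) !big_seq_fset1 !mcoeffUU. Qed.

Lemma gamulDl : left_distributive gamul +%R.
Proof.
move=> x y z.
rewrite [X in _ = X + _](gamulEw (fsubsetUl _ (msupp y)) (fsubset_refl _)).
rewrite [X in _ = _ + X](gamulEw (fsubsetUr (msupp x) _) (fsubset_refl _)).
rewrite (gamulEw (msuppD_le _ _) (fsubset_refl _)).
rewrite -big_split /=; apply/eq_bigr=> k1 _.
rewrite -big_split /=; apply/eq_bigr=> k2 _.
by rewrite mcoeffD mulrDl monalgUD.
Qed.

Lemma gamulDr : right_distributive gamul +%R.
Proof.
move=> z x y.
rewrite [X in _ = X + _](gamulEw (fsubset_refl _) (fsubsetUl _ (msupp y))).
rewrite [X in _ = _ + X](gamulEw (fsubset_refl _) (fsubsetUr (msupp x) _)).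
rewrite (gamulEw (fsubset_refl _) (msuppD_le _ _)).
rewrite -big_split /=; apply/eq_bigr=> k1 _.
rewrite -big_split /=; apply/eq_bigr=> k2 _.
by rewrite mcoeffD mulrDr monalgUD.
Qed.

Lemma gamulA : associative gamul.
Proof.
have suml (I : Type) (r : seq I) (F : I -> A) y :
    gamul (\sum_(i <- r) F i) y = \sum_(i <- r) gamul (F i) y.
  by rewrite (big_morph (gamul^~ y) (fun _ _ => gamulDl _ _ _) (gamul0l _)).
have sumr (I : Type) (r : seq I) (F : I -> A) x :
    gamul x (\sum_(i <- r) F i) = \sum_(i <- r) gamul x (F i).
  by rewrite (big_morph (gamul x) (fun _ _ => gamulDr _ _ _) (gamul0r _)).
have gaE (x : A) : x = \sum_(g <- msupp x) (<< x@_g *g g >> : A).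
  exact: monalgE.
move=> x y z; rewrite (gaE x) (suml _ _ _ (gamul y z)) (suml _ _ _ y).
rewrite (suml _ _ _ z); apply/eq_bigr=> k1 _.
rewrite (gaE y) (suml _ _ _ z) !sumr (suml _ _ _ z); apply/eq_bigr=> k2 _.
rewrite (gaE z) !sumr; apply/eq_bigr=> k3 _.
by rewrite !gamulUU mulrA mulgA.
Qed.

Lemma gamul1l : left_id (gadelta 1%g) gamul.
Proof.
move=> x; rewrite gamulUl [RHS]monalgE.
by apply/eq_bigr=> g _; rewrite mul1r mul1g.
Qed.

Lemma gamul1r : right_id (gadelta 1%g) gamul.
Proof.
move=> x; rewrite gamulUr [RHS]monalgE.
by apply/eq_bigr=> g _; rewrite mulr1 mulg1.
Qed.

Lemma gadelta1_neq0 : gadelta 1%g != 0.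
Proof. by apply/eqP/malgP=> /(_ 1%g) /eqP; rewrite !mcoeffsE oner_eq0. Qed.

HB.instance Definition _ := GRing.Zmodule_isNzRing.Build (group_algebra R G)
  gamulA gamul1l gamul1r gamulDl gamulDr gadelta1_neq0.

Lemma gadeltaM : {morph gadelta : g h / (g * h)%g >-> g * h}.
Proof. by move=> g h; rewrite [RHS]gamulUU mulr1. Qed.

Lemma gadelta1 : gadelta 1%g = 1. Proof. by []. Qed.

End GroupAlgebra.

Section FiniteOrder.
Variables (F : fieldType) (G : groupType).
Implicit Types g h : G.

(* G^fin *)
Definition fin_order g : Prop := exists d, (0 < d)%N && ((g ^+ d)%g == 1%g).

(* The value 0 outside G^fin is a convention that is never relevant. *)
Definition ord_elt g : nat :=
  if pselect (fin_order g) is left fin_g then ex_minn fin_g else 0%N.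

Definition fin_proj g : group_algebra F G :=
  (ord_elt g)%:R^-1 *: \sum_(i < ord_elt g) gadelta F (g ^+ i)%g.

Definition sim_fin g h : Prop :=
  exists gamma : G,
    fin_proj g = gadelta F gamma * fin_proj h * gadelta F (gamma^-1)%g.

Lemma sim_fin_refl g : sim_fin g g.
Proof. by exists 1%g; rewrite invg1 gadelta1 mul1r mulr1. Qed.

Lemma sim_fin_sym g h : sim_fin g h -> sim_fin h g.
Proof.
move=> [c eq_gh]; exists (c^-1)%g; rewrite eq_gh invgK -!mulrA -gadeltaM mulVg.
by rewrite gadelta1 mulr1 mulrA -gadeltaM mulVg gadelta1 mul1r.
Qed.

Lemma sim_fin_trans g h k : sim_fin g h -> sim_fin h k -> sim_fin g k.
Proof.
move=> [c eq_gh] [d eq_hk]; exists (c * d)%g.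
by rewrite eq_gh eq_hk invgM !gadeltaM !mulrA.
Qed.

End FiniteOrder.

Section Count.
Variable gT : finGroupType.

Lemma ord_eltE (g : gT) : ord_elt g = #[g]%g.
Proof.
rewrite /ord_elt; case: pselect => [fin_g|[]]; last first.
  by exists #[g]%g; rewrite order_gt0 expg_order eqxx.
case: ex_minnP => d /andP[d_gt0 /eqP gd1] min_d.
apply/eqP; rewrite eqn_leq min_d ?order_gt0 ?expg_order ?eqxx //=.
by rewrite dvdn_leq // order_dvdn gd1.
Qed.

Lemma sim_fin_equiv :
  equivalence_rel (fun g h : gT => `[< sim_fin CC g h >]).
Proof.
move=> x y z; split; first exact/asboolP/sim_fin_refl.
move=> /asboolP sxy; apply: asbool_equiv_eq; split.
  exact/sim_fin_trans/sim_fin_sym.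
exact: sim_fin_trans.
Qed.

Definition nb_fin_classes : nat :=
  #|equivalence_partition (fun g h => `[< sim_fin CC g h >])
      [set g : gT | `[< fin_order g >]]|.

End Count.

(* Main.v *)
Require Import Defs.
From mathcomp Require Import all_boot all_fingroup.
From mathcomp Require Import ssralg ssrnum cyclic finmap boolp monalg.

(** For a finite group, the idempotent [p_g] is the normalised sum of the
    elements of the cyclic group [<[g]>].  In characteristic zero its support
    is exactly [<[g]>], so [p_g] and the subgroup [<[g]>] determine each other;
    since conjugating [p_h] conjugates [h], two elements are related by
    [sim_fin] if and only if the cyclic subgroups that they generate are
    conjugate ([sim_finP]).

    In a symmetric group this relation is conjugacy of elements.  Two
    permutations [s] and [t] that generate the same cyclic group have the same
    orbits.  Both permute each common orbit in a single cycle, so sending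
    [s^i r] to [t^i r], for a chosen point [r] in each orbit, is a permutation,
    and it conjugates [s] into [t] ([eq_fconnect_conj]).  Hence the
    [sim_fin]-classes are exactly the conjugacy classes. *)

Set Implicit Arguments.
Unset Strict Implicit.
Unset Printing Implicit Defensive.

Import GRing.Theory Num.Theory.

Section GroupAlgebraScaling.
Variables (R : comNzRingType) (G : groupType).
Implicit Types (a b : R) (x y : group_algebra R G).
Local Open Scope ring_scope.

Let scaleU a b (g : G) : a *: << b *g g >> = << a * b *g g >> :> {malg R[G]}.
Proof. by apply/malgP=> h; rewrite mcoeffZ !mcoeffU mulrnAr. Qed.

Lemma gamulZl a x y : (a *: x) * y = a *: (x * y).
Proof.
rewrite [LHS](gamulEw (msuppZ_le _ _) (fsubset_refl _)) scaler_sumr.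
apply: eq_bigr => g _; rewrite scaler_sumr; apply: eq_bigr => h _.
by rewrite mcoeffZ [RHS]scaleU mulrA.
Qed.

Lemma gamulZr a x y : x * (a *: y) = a *: (x * y).
Proof.
rewrite [LHS](gamulEw (fsubset_refl _) (msuppZ_le _ _)) scaler_sumr.
apply: eq_bigr => g _; rewrite scaler_sumr; apply: eq_bigr => h _.
by rewrite mcoeffZ [RHS]scaleU mulrCA.
Qed.
End GroupAlgebraScaling.

Section FiniteOrderProjection.
Variables (F : numFieldType) (gT : finGroupType).
Implicit Types g h c : gT.
Local Open Scope ring_scope.

Lemma fin_projE g :
  fin_proj F g = #|<[g]>%g|%:R^-1 *: \sum_(x in <[g]>%g) gadelta F x.
Proof.
rewrite /fin_proj ord_eltE; congr (_ *: _).
have -> : <[g]>%g = [set (g ^+ val i)%g | i : 'I_#[g]%g].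
  apply/setP=> x; apply/idP/imsetP => [/cyclePmin[i lt_i ->]|[i _ ->]].
    by exists (Ordinal lt_i).
  exact: mem_cycle.
rewrite big_imset //= => i j _ _ /eqP.
by rewrite eq_expg_ord // => /eqP.
Qed.

(** The common value [1/d] of the coefficients on the cyclic group is nonzero
    because [F] has characteristic zero. *)
Lemma mcoeff_fin_proj_neq0 g x :
  (mcoeff x (fin_proj F g) != 0) = (x \in <[g]>%g).
Proof.
rewrite fin_projE mcoeffZ raddf_sum /=.
have -> : \sum_(y in <[g]>%g) mcoeff x (gadelta F y) = (x \in <[g]>%g)%:R.
  under eq_bigr => y _ do rewrite mcoeffU.
  case: (boolP (x \in _)) => [xg|xg'].
    rewrite (bigD1 x) //= eqxx big1 ?addr0 // => y /andP[_ /negPf ->] //.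
  by rewrite big1 // => y yg; case: eqP => // eq_yx; rewrite -eq_yx yg in xg'.
by rewrite mulf_eq0 negb_or invr_eq0 !pnatr_eq0 -lt0n cardG_gt0 eqb0 negbK.
Qed.

Lemma eq_fin_proj g h : (fin_proj F g = fin_proj F h) <-> (<[g]> = <[h]>)%g.
Proof.
split=> [eq_gh|eq_gh]; last by rewrite !fin_projE eq_gh.
by apply/setP=> x; rewrite -!mcoeff_fin_proj_neq0 eq_gh.
Qed.

Lemma fin_projJ g c :
  gadelta F c * fin_proj F g * gadelta F (c^-1)%g = fin_proj F (g ^ c^-1)%g.
Proof.
rewrite /fin_proj !ord_eltE orderJ.
rewrite gamulZr gamulZl mulr_sumr mulr_suml; congr (_ *: _); apply: eq_bigr => i _.
by rewrite -!gadeltaM -conjXg conjgE invgK mulgA.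
Qed.

(** Conjugation in the group algebra carries [p_h] to another idempotent of the
    same kind, and such an idempotent retains nothing of its element beyond the
    subgroup generated. *)
Lemma sim_finP g h :
  sim_fin F g h <-> exists c, (<[g]> = <[h ^ c]>)%g.
Proof.
split=> [[c]|[c /eq_fin_proj eq_gh]].
  by rewrite fin_projJ => /eq_fin_proj eq_gh; exists (c^-1)%g.
by exists (c^-1)%g; rewrite fin_projJ invgK.
Qed.

End FiniteOrderProjection.

Section OrbitConjugation.
Variables (T : finType) (s t : {perm T}).
Hypothesis eq_st : fconnect s =2 fconnect t.

Let rep x := froot s x.
(** [align] sends [s^i r] to [t^i r], where [r] is the chosen point of the
    orbit; [findex] recovers the least such [i]. *)
Let align x := iter (findex s (rep x) x) t (rep x).

Let rep_connect x : fconnect s (rep x) x.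
Proof. by rewrite (fconnect_sym perm_inj) connect_root. Qed.

Let eq_rep x y : fconnect s x y -> rep x = rep y.
Proof. by move/(rootP (fconnect_sym perm_inj)). Qed.

Let eq_order x : fingraph.order s x = fingraph.order t x.
Proof. exact/eq_card/eq_st. Qed.

Let align_step x : align (s x) = t (align x).
Proof.
rewrite /align -(eq_rep (fconnect1 s x)) -iterS.
set k := findex s (rep x) x.
have sxE : s x = iter k.+1 s (rep x) by rewrite iterS iter_findex.
have lt_k : k < fingraph.order s (rep x) by rewrite findex_max.
have [lt_k1|ge_k1] := ltnP k.+1 (fingraph.order s (rep x)).
  by rewrite sxE findex_iter.
(* At the last point of the cycle both iterates are back at [rep x]. *)
have k1E : k.+1 = fingraph.order s (rep x) by apply/eqP; rewrite eqn_leq lt_k.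
rewrite sxE k1E (iter_order perm_inj) findex0.
by rewrite eq_order (iter_order perm_inj).
Qed.

(** [align x] stays in the orbit of [x], hence determines [rep x]; its position
    on the [t]-cycle from there is the position of [x] on the [s]-cycle. *)
Let align_inj : injective align.
Proof.
move=> x y eq_xy.
have eq_r: rep x = rep y.
  have rep_align z : rep (align z) = rep z.
    have /eq_rep <- : fconnect s (rep z) (align z).
      by rewrite eq_st fconnect_iter.
    exact: eq_rep.
  by rewrite -rep_align eq_xy rep_align.
have findex_align z : findex t (rep z) (align z) = findex s (rep z) z.
  by rewrite findex_iter // -eq_order findex_max.
rewrite -(iter_findex (rep_connect x)) -(iter_findex (rep_connect y)).
by rewrite -!findex_align eq_xy eq_r.
Qed.

Lemma eq_fconnect_conj : exists c : {perm T}, t = (s ^ c)%g.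
Proof.
exists (perm align_inj); apply/permP=> y.
by rewrite -(permKV (perm align_inj) y) permJ !permE align_step.
Qed.
End OrbitConjugation.

(** [s] and [t] have the same orbits, these being the orbits of the group that
    each of them generates. *)
Lemma eq_cycle_conj (T : finType) (s t : {perm T}) :
  <[s]>%g = <[t]>%g -> exists c : {perm T}, t = (s ^ c)%g.
Proof.
move=> eq_st; apply: eq_fconnect_conj => x y.
have fconnectE (u : {perm T}) : fconnect u x y = (y \in porbit u x).
  apply/idP/porbitP => [/iter_findex <-|[i ->]].
    by exists (findex u x y); rewrite permX.
  by rewrite permX fconnect_iter.
by rewrite !fconnectE porbit.unlock eq_st.
Qed.

(** In a general group [sim_fin] is coarser than conjugacy, since it identifies
    all generators of a cyclic subgroup; in a symmetric group these generators
    are already conjugate. *)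
Lemma sim_fin_perm (F : numFieldType) (T : finType) (s t : {perm T}) :
  sim_fin F s t <-> t \in (s ^: [set: {perm T}])%g.
Proof.
split=> [/sim_finP[c /eq_cycle_conj[d eq_d]]|/imsetP[c _ ->]].
  apply/imsetP; exists (d * c^-1)%g; rewrite ?inE //.
  by rewrite conjgM -eq_d conjgK.
by apply/sim_finP; exists (c^-1)%g; rewrite conjgK.
Qed.

Theorem proposition5p14 (n : nat) :
  nb_fin_classes 'S_n = #|classes [set: 'S_n]|.
Proof.
rewrite /nb_fin_classes /equivalence_partition /classes.
have -> : [set g : 'S_n | `[< fin_order g >]] = [set: 'S_n].
  apply/setP=> g; rewrite !inE; apply/asboolP; exists #[g]%g.
  by rewrite order_gt0 expg_order eqxx.
congr #|pred_of_set _|; apply: eq_imset => s; apply/setP=> t.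
rewrite inE in_setT /=; apply/asboolP/idP => [/sim_fin_perm//|st].
exact/sim_fin_perm.
Qed.
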